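(* Suppose that: (i) $\mathcal J:\mathcal X\to[0,+\infty]$ is proper, convex and weakly-* lower semicontinuous, and its non-empty sublevel sets are weakly-* sequentially compact; (ii) $\mathcal H(\cdot\mid\cdot):\mathcal Y\times\mathcal Y\to[0,+\infty]$ is proper, convex in its first argument, weakly-* lower semicontinuous jointly in both arguments, and $\mathcal H(v\mid f)=0$ if and only if $v=f$; (iii) the operators $A,A^l_n,A^u_n:\mathcal X\to\mathcal Y$ are weak-* to weak-* continuous. For $\alpha>0$ let $(u^\alpha_n,v^\alpha_n)$ solve $$\min_{u\in\mathcal X,\ v\in\mathcal Y}\frac1\alpha\mathcal H(v\mid f_n)+\mathcal J(u)\quad\text{subject to}\quad A^l_nu\le v\le A^u_nu,$$ and let $\alpha_n>0$ be chosen according to the discrepancy principle $$\alpha_n=\sup\{\alpha>0:\mathcal H(v^\alpha_n\mid f_n)\le\tau\delta_n\},\qquad\tau>1,$$ with $v^{\alpha_n}_n$ such that $\mathcal H(v^{\alpha_n}_n\mid f_n)=\tau\delta_n$. Then $u^{\alpha_n}_n$ converges weakly-* to a $\mathcal J$-minimising solution of $Au=\bar f$.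
   Context: $\mathcal X=\mathcal U^*$ and $\mathcal Y=\mathcal V^*$ are duals of Banach lattices with the dual norm and dual partial order ($y\ge0$ iff $\langle y,v\rangle\ge0$ for all $v\in\mathcal V$, $v\ge0$). $A:\mathcal X\to\mathcal Y$ is a bounded linear regular operator (difference of two positive operators) and $\bar f\in\mathcal Y$ is the exact data. A $\mathcal J$-minimising solution is an element $u$ with $Au=\bar f$ and $\mathcal J(u)\le\mathcal J(w)$ for all $w$ with $Aw=\bar f$; it is assumed that there exists a non-negative one, $u^\dagger_{\mathcal J}\ge0$, with $\mathcal J(u^\dagger_{\mathcal J})<\infty$. The bounded linear operators $A^l_n,A^u_n$, data $f_n\in\mathcal Y$ and numbers $\delta_n>0$, $\eta_n$ satisfy $A^l_n\le A\le A^u_n$ for all $n$ (i.e. $A^l_nu\le Au\le A^u_nu$ for all $u\ge0$), $\|A^u_n-A^l_n\|\le\eta_n\to0$, $\mathcal H(\bar f\mid f_n)\le\delta_n$ for all $n$, and $\delta_n\to0$. The parameter $\tau>1$ does not depend on $n$.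
   Formalization: It is additionally assumed that f_n converges weakly-* to the exact data; the conclusion is that every subsequence of the u_n has a further subsequence converging weakly-* to a J-minimising solution, and the whole sequence converges if that solution is unique. *)

(* Defs.v *)
From HB Require Import structures.
From mathcomp Require Import all_boot all_order all_algebra.
From mathcomp Require Import all_classical all_reals all_analysis.

Set Implicit Arguments.
Unset Strict Implicit.
Unset Printing Implicit Defensive.

Import Order.TTheory GRing.Theory Num.Theory.
Import numFieldNormedType.Exports.
Local Open Scope classical_set_scope.
Local Open Scope ring_scope.

(* The order and the lattice operations are fields of the mixin: Hierarchy
   Builder cannot join CompleteNormedModule with Order.Lattice, because
   Num.RealDomain already inherits from both of their ancestors. *)
HB.mixin Record isBanachLattice (R : realType) V
    & CompleteNormedModule R V := {
  bl_le : rel V ;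
  bl_join : V -> V -> V ;
  bl_meet : V -> V -> V ;
  bl_le_refl : reflexive bl_le ;
  bl_le_anti : antisymmetric bl_le ;
  bl_le_trans : transitive bl_le ;
  bl_joinP : forall x y z,
    bl_le (bl_join x y) z = bl_le x z && bl_le y z ;
  bl_meetP : forall x y z,
    bl_le z (bl_meet x y) = bl_le z x && bl_le z y ;
  bl_leD2r : forall z x y, bl_le x y -> bl_le (x + z) (y + z) ;
  bl_leZ : forall (a : R) x y, 0 <= a -> bl_le x y ->
    bl_le (a *: x) (a *: y) ;
  (* bl_join x (- x) is the modulus of x *)
  bl_le_norm : forall x y,
    bl_le (bl_join x (- x)) (bl_join y (- y)) -> `|x| <= `|y|
}.

#[short(type="banachLatticeType")]
HB.structure Definition BanachLattice (R : realType) :=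
  {V of CompleteNormedModule R V & isBanachLattice R V}.

Section opnorm.
Context {R : realType} {V W : normedModType R}.

Definition opnorm (f : V -> W) : R :=
  sup [set `|f x| | x in [set x : V | `|x| <= 1]].

Lemma has_sup_opnorm (f : V -> W) : linear f -> continuous f ->
  has_sup [set `|f x| | x in [set x : V | `|x| <= 1]].
Proof.
move=> lf cf; split; first by exists `|f 0|, 0 => //=; rewrite normr0.
pose L : {linear V -> W} := HB.pack f (GRing.isLinear.Build _ _ _ _ _ lf).
have /linear_boundedP/pinfty_ex_gt0[M M0 fM] : bounded_near L (nbhs 0).
  exact/linear_bounded_continuous.
exists M => _ [x /= x1 <-]; apply: (le_trans (fM x)).
by rewrite ler_piMr// ltW.
Qed.

Lemma opnorm_ge (f : V -> W) : linear f -> continuous f ->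
  forall x, `|x| <= 1 -> `|f x| <= opnorm f.
Proof.
by move=> lf cf x x1; apply: sup_upper_bound; [exact: has_sup_opnorm|exists x].
Qed.

Lemma opnorm_le (f : V -> W) (M : R) :
  (forall x, `|x| <= 1 -> `|f x| <= M) -> opnorm f <= M.
Proof.
move=> fM; apply: ge_sup; first by exists `|f 0|, 0 => //=; rewrite normr0.
by move=> _ [x x1 <-]; exact: fM.
Qed.

End opnorm.

Section dual.
Context {R : realType} (U : normedModType R).

Definition dual_pred : {pred U -> R^o} :=
  [pred f : U -> R^o | `[< linear f /\ continuous f >]].

Lemma dual_submod_closed : submod_closed dual_pred.
Proof.
split=> [|a f g /asboolP[lf cf] /asboolP[lg cg]]; apply/asboolP; split.
- by move=> a x y; rewrite /= scaler0 addr0.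
- by move=> x; exact: cvg_cst.
- move=> b x y; rewrite !fctE /= lf lg.
  by rewrite !scalerDr !scalerA (mulrC a b) addrACA.
- by move=> x; apply: continuousD; [apply: continuousZl_tmp; exact: cf|exact: cg].
Qed.

HB.instance Definition _ :=
  GRing.isSubmodClosed.Build R (U -> R^o) dual_pred dual_submod_closed.

Record dual := Dual { dual_val :> U -> R^o; _ : dual_val \in dual_pred }.

HB.instance Definition _ := [isSub for dual_val].
HB.instance Definition _ := gen_eqMixin dual.
HB.instance Definition _ := gen_choiceMixin dual.
HB.instance Definition _ := [SubChoice_isSubLmodule of dual by <:].

Lemma dual_linear (f : dual) : linear f.
Proof. by case: f => f /= /asboolP[]. Qed.

Lemma dual_continuous (f : dual) : continuous f.
Proof. by case: f => f /= /asboolP[]. Qed.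

Definition dual_norm (f : dual) : R := opnorm f.

Lemma dual_ler_normD f g : dual_norm (f + g) <= dual_norm f + dual_norm g.
Proof.
apply: opnorm_le => x x1; apply: (le_trans (ler_normD _ _)).
by apply: lerD; apply: opnorm_ge => //;
  [exact: dual_linear|exact: dual_continuous|
   exact: dual_linear|exact: dual_continuous].
Qed.

Lemma dual_normrZ_le (a : R) f : dual_norm (a *: f) <= `|a| * dual_norm f.
Proof.
apply: opnorm_le => x x1; rewrite [`|_|]normrZ ler_wpM2l//.
by apply: opnorm_ge => //; [exact: dual_linear|exact: dual_continuous].
Qed.

Lemma dual_normrZ (a : R) f : dual_norm (a *: f) = `|a| * dual_norm f.
Proof.
apply/eqP; rewrite eq_le dual_normrZ_le/=.
have [->|a0] := eqVneq a 0.
  rewrite normr0 mul0r scale0r.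
  rewrite (le_trans (normr_ge0 ((0 : dual) 0)))//.
  by apply: opnorm_ge; [exact: dual_linear|exact: dual_continuous|rewrite normr0].
rewrite -ler_pdivlMl ?normr_gt0// -normfV.
by rewrite -[leLHS](_ : dual_norm (a^-1 *: (a *: f)) = _) ?dual_normrZ_le//
  scalerA mulVf// scale1r.
Qed.

Lemma dual_normr0_eq0 f : dual_norm f = 0 -> f = 0.
Proof.
move=> f0; apply: val_inj; apply/funext => x /=.
have f1 y : `|y| <= 1 -> f y = 0.
  move=> y1; apply/eqP; rewrite -normr_le0 -f0.
  by apply: opnorm_ge => //; [exact: dual_linear|exact: dual_continuous].
have [->|x0] := eqVneq x 0; first by apply: f1; rewrite normr0.
pose L : {linear U -> R^o} :=
  HB.pack (dual_val f) (GRing.isLinear.Build _ _ _ _ _ (dual_linear f)).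
have : L (`|x|^-1 *: x) = 0.
  by apply: f1; rewrite normrZ normfV normr_id mulVf ?normr_eq0.
by rewrite linearZ/= => /eqP; rewrite scaler_eq0 invr_eq0 normr_eq0
  (negPf x0)/= => /eqP.
Qed.

HB.instance Definition _ := Lmodule_isNormed.Build R dual
  dual_ler_normD dual_normrZ dual_normr0_eq0.

(* The same set of functionals, with the topology of pointwise convergence
   instead of the norm topology. *)
Definition weakstar : Type := dual.

HB.instance Definition _ := Topological.copy weakstar
  (initial_topology (fun f : dual =>
     ((f : U -> R) : prod_topology (fun _ : U => R)))).

End dual.

Definition dual_le {R : realType} {U : banachLatticeType R} (f g : dual U) : Prop :=
  forall x : U, bl_le 0 x -> f x <= g x.

Section operators.
Context {R : realType} {U V : banachLatticeType R}.

Definition positive_op (A : dual U -> dual V) :=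
  forall u, dual_le 0 u -> dual_le 0 (A u).

Definition regular_op (A : dual U -> dual V) :=
  exists P Q : {linear dual U -> dual V},
    [/\ positive_op P, positive_op Q & A = P \- Q].

Definition op_le (A B : dual U -> dual V) :=
  forall u, dual_le 0 u -> dual_le (A u) (B u).

Definition weakstar_continuous (A : dual U -> dual V) :=
  continuous (A : weakstar U -> weakstar V).

End operators.

Section functionals.
Local Open Scope ereal_scope.

Definition proper_functional {R : realType} {T : Type} (F : T -> \bar R) :=
  (exists x, F x < +oo) /\ (forall x, -oo < F x).

Definition convex_functional {R : realType} {L : lmodType R} (F : L -> \bar R) :=
  forall (t : R) (x y : L), (0 <= t <= 1)%R ->
    F (t *: x + (1 - t) *: y)%R <= t%:E * F x + (1 - t)%:E * F y.

End functionals.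

Definition seq_compact {T : topologicalType} (S : set T) :=
  forall x : nat -> T, (forall n, S (x n)) ->
    exists2 phi : nat -> nat, increasing_seq phi &
    exists2 l, S l & x \o phi @ \oo --> l.

(* Convergence up to subsequences to a set: every subsequence has a further
   subsequence with limit in S.  Then the limit of every convergent subsequence
   lies in S if T is Hausdorff, and x converges to l if S is [set l]. *)
Definition subseq_cvg_to {T : topologicalType} (x : nat -> T) (S : set T) :=
  forall phi : nat -> nat, increasing_seq phi ->
    exists2 psi : nat -> nat, increasing_seq psi &
    exists2 l, S l & x \o phi \o psi @ \oo --> l.

Section variational_problem.
Context {R : realType} {U V : banachLatticeType R}.
Local Open Scope ereal_scope.

Definition Jminimising (J : dual U -> \bar R) (A : dual U -> dual V)
    (f : dual V) : set (dual U) :=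
  [set u | A u = f /\ forall w, A w = f -> J u <= J w].

Definition feasible (Al Au : dual U -> dual V) (u : dual U) (v : dual V) :=
  dual_le (Al u) v /\ dual_le v (Au u).

Definition objective (H : dual V -> dual V -> \bar R) (J : dual U -> \bar R)
    (f : dual V) (alpha : R) (u : dual U) (v : dual V) :=
  (alpha^-1)%:E * H v f + J u.

Definition solves (Al Au : dual U -> dual V)
    (H : dual V -> dual V -> \bar R) (J : dual U -> \bar R)
    (f : dual V) (alpha : R) (u : dual U) (v : dual V) :=
  feasible Al Au u v /\
  forall u' v', feasible Al Au u' v' ->
    objective H J f alpha u v <= objective H J f alpha u' v'.

End variational_problem.

(* Main.v *)
Require Import Defs.
From HB Require Import structures.
From mathcomp Require Import all_boot all_order all_algebra.
From mathcomp Require Import all_classical all_reals all_analysis.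
From mathcomp Require Import lra.
Import Order.TTheory GRing.Theory Num.Theory.
Import numFieldNormedType.Exports.
Local Open Scope classical_set_scope.
Local Open Scope ring_scope.

(** Two facts about the regularised pairs drive the convergence.

    Bounds.  Every J-minimising solution u0 >= 0 together with the exact data
    is feasible for each perturbed problem, since Al u0 <= A u0 <= Au u0.
    Comparing objective values and using that the discrepancy of the computed
    pair equals tau * delta, which exceeds the discrepancy bound delta of the
    exact data, leaves J (u_n) <= J u0.  So the u_n lie in one sublevel set of
    J, and any subsequence has a further subsequence with a weak-* limit l in
    that sublevel set.

    Identification of the limit.  Along such a subsequence the u_n are bounded
    in norm (uniform boundedness, [weakstar_cvg_bounded]), and feasibility
    forces v_n to be within a constant times eta_n |u_n| of A u_n
    ([feasible_near]); so v_n tends weakly-* to A l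
    ([feasible_weakstar_cvg]).  Joint lower semicontinuity of H and
    H (v_n | f_n) = tau * delta_n --> 0 give H (A l | fbar) = 0, that is
    A l = fbar.  As J l <= J u0, the limit l is J-minimising.  If the
    J-minimising solution is unique, the whole sequence converges to it, because
    a sequence staying outside a neighbourhood along a subsequence could not
    have a further subsequence converging to the centre.

    The delicate point is [feasible_near], because the u_n need not be
    non-negative whereas the operators are ordered on the positive cone only.
    It splits u_n into two positive functionals of comparable norm, one of
    which is a positive majorant of u_n ([dual_majorant]).  The majorant is the
    Riesz-Kantorovich positive part: on the cone it is
    x |-> sup of w over the order interval [0, x], which is additive there by
    the Riesz decomposition property, and it extends linearly to differences of
    positive elements. *)

Set Implicit Arguments.
Unset Strict Implicit.

(** * Order and norm in a Banach lattice *)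

Lemma bl_leBr {R : realType} {V : banachLatticeType R} (x y : V) :
  bl_le 0 (y - x) = bl_le x y.
Proof.
by apply/idP/idP => [/(bl_leD2r x _ _)|/(bl_leD2r (- x) _ _)];
  rewrite ?add0r ?subrK ?subrr.
Qed.

Lemma bl_addr_ge0 {R : realType} {V : banachLatticeType R} (x y : V) :
  bl_le 0 x -> bl_le 0 y -> bl_le 0 (x + y).
Proof.
by move=> x0 /(bl_leD2r x _ _); rewrite add0r [y + x]addrC; exact: bl_le_trans.
Qed.

Lemma bl_scaler_ge0 {R : realType} {V : banachLatticeType R} (a : R) (x : V) :
  0 <= a -> bl_le 0 x -> bl_le 0 (a *: x).
Proof. by move=> a0 /(bl_leZ _ _ _ a0); rewrite scaler0. Qed.

Lemma bl_le_joinl {R : realType} {V : banachLatticeType R} (x y : V) :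
  bl_le x (bl_join x y).
Proof.
by have := bl_le_refl (bl_join x y); rewrite bl_joinP => /andP[].
Qed.

Lemma bl_le_joinr {R : realType} {V : banachLatticeType R} (x y : V) :
  bl_le y (bl_join x y).
Proof.
by have := bl_le_refl (bl_join x y); rewrite bl_joinP => /andP[].
Qed.

Lemma bl_norm_mono {R : realType} {V : banachLatticeType R} (x y : V) :
  bl_le 0 x -> bl_le x y -> `|x| <= `|y|.
Proof.
move=> x0 xy; have y0 := bl_le_trans _ _ _ x0 xy.
have yj := bl_le_joinl y (- y); apply: bl_le_norm; rewrite bl_joinP.
rewrite (bl_le_trans _ _ _ xy yj)/=.
apply: (bl_le_trans 0); last exact: bl_le_trans yj.
by rewrite -bl_leBr opprK add0r.
Qed.

Definition bl_pos {R : realType} {V : banachLatticeType R} (x : V) : V :=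
  bl_join x 0.

Lemma bl_pos_ge0 {R : realType} {V : banachLatticeType R} (x : V) :
  bl_le 0 (bl_pos x).
Proof. exact: bl_le_joinr. Qed.

Lemma bl_neg_ge0 {R : realType} {V : banachLatticeType R} (x : V) :
  bl_le 0 (bl_pos x - x).
Proof. by rewrite bl_leBr; exact: bl_le_joinl. Qed.

(** The modulus m dominates both x and - x, so m - x and m + x are positive and
    so is half of their sum, which is m. *)
Lemma bl_modulus_ge0 {R : realType} {V : banachLatticeType R} (x : V) :
  bl_le 0 (bl_join x (- x)).
Proof.
have := bl_le_joinl x (- x); rewrite -bl_leBr => m1.
have := bl_le_joinr x (- x); rewrite -bl_leBr => m2.
have h : (0 : R) <= 2^-1 by rewrite invr_ge0.
have := bl_scaler_ge0 h (bl_addr_ge0 m1 m2).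
rewrite opprK addrACA addNr addr0 -mulr2n -(scaler_nat 2 (bl_join _ _)).
by rewrite scalerA mulVf// scale1r.
Qed.

Lemma bl_norm_pos {R : realType} {V : banachLatticeType R} (x : V) :
  `|bl_pos x| <= `|x|.
Proof.
have m0 := bl_modulus_ge0 x.
apply: bl_le_norm; rewrite bl_joinP; apply/andP; split.
  by rewrite bl_joinP bl_le_joinl m0.
by apply: bl_le_trans m0; rewrite -bl_leBr opprK add0r; exact: bl_pos_ge0.
Qed.

Lemma bl_norm_neg {R : realType} {V : banachLatticeType R} (x : V) :
  `|bl_pos x - x| <= 2 * `|x|.
Proof.
rewrite (le_trans (ler_normB _ _))//; have := bl_norm_pos x; lra.
Qed.

(** * Norm bounds for functionals *)

Lemma opnorm_ge0 {R : realType} {V W : normedModType R} (f : V -> W) :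
  linear f -> continuous f -> 0 <= opnorm f.
Proof.
move=> lf cf; apply: (le_trans (normr_ge0 (f 0))).
by apply: opnorm_ge; rewrite ?normr0.
Qed.

Lemma opnorm_ler {R : realType} {V W : normedModType R} (f : V -> W) :
  linear f -> continuous f -> forall x, `|f x| <= opnorm f * `|x|.
Proof.
move=> lf cf x.
pose L : {linear V -> W} :=
  HB.pack f (GRing.isLinear.Build _ _ _ _ _ lf).
have [->|x0] := eqVneq x 0.
  by rewrite [f 0](linear0 L) !normr0 mulr0.
have nx : 0 < `|x| by rewrite normr_gt0.
have : `|L (`|x|^-1 *: x)| <= opnorm f.
  by apply: opnorm_ge => //; rewrite normrZ normfV normr_id mulVf ?gt_eqF.
by rewrite linearZ/= normrZ normfV normr_id ler_pdivrMl// mulrC.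
Qed.

Lemma dual_ler {R : realType} {U : normedModType R} (w : dual U) x :
  `|w x| <= `|w| * `|x|.
Proof.
exact: (opnorm_ler (dual_linear w) (@dual_continuous _ _ w)).
Qed.

Lemma dual_norm_le {R : realType} {U : normedModType R} (w : dual U) (M : R) :
  (forall x, `|w x| <= M * `|x|) -> 0 <= M -> `|w| <= M.
Proof.
move=> wM M0; apply: opnorm_le => x x1; apply: (le_trans (wM x)).
exact: ler_piMr.
Qed.

Lemma dual_of_bounded_linear {R : realType} {U : normedModType R}
    (g : U -> R) (M : R) :
  (forall a x y, g (a *: x + y) = a * g x + g y) ->
  (forall x, `|g x| <= M * `|x|) -> exists p : dual U, forall x, p x = g x.
Proof.
move=> lg gM; have lg' : linear (g : U -> R^o) by [].
pose L : {linear U -> R^o} :=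
  HB.pack (g : U -> R^o) (GRing.isLinear.Build _ _ _ _ _ lg').
have cg : continuous (g : U -> R^o).
  apply/(linear_bounded_continuous L)/linear_boundedP.
  exists M; split; first exact: num_real.
  by move=> r Mr x; rewrite (le_trans (gM x))// ler_wpM2r// ltW.
have dg : (g : U -> R^o) \in @dual_pred R U by apply/asboolP.
by exists (Dual dg).
Qed.

Lemma dual0 {R : realType} {U : normedModType R} (w : dual U) : w 0 = 0.
Proof.
exact: (linear0 (HB.pack (dual_val w)
  (GRing.isLinear.Build _ _ _ _ _ (dual_linear w)) : {linear U -> R^o})).
Qed.

Lemma dualD {R : realType} {U : normedModType R} (w : dual U) x y :
  w (x + y) = w x + w y.
Proof. by have := dual_linear w 1 x y; rewrite !scale1r. Qed.

Lemma dualZ {R : realType} {U : normedModType R} (w : dual U) (a : R) x :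
  w (a *: x) = a * w x.
Proof. by have := dual_linear w a x 0; rewrite dual0 !addr0. Qed.

(** * Positive majorants in the dual of a Banach lattice *)

Section dual_majorant.
Context {R : realType} {V : banachLatticeType R} (w : dual V).

Definition order_interval_image (x : V) : set R :=
  [set w y | y in [set y | bl_le 0 y /\ bl_le y x]].

(** The Riesz-Kantorovich formula for the positive part of [w] at [0 <= x]. *)
Definition interval_sup (x : V) : R := sup (order_interval_image x).

Lemma order_interval_image_le x r :
  order_interval_image x r -> r <= `|w| * `|x|.
Proof.
move=> [y [y0 yx] <-]; rewrite (le_trans (ler_norm _))//.
by rewrite (le_trans (dual_ler _ _))// ler_wpM2l// bl_norm_mono.
Qed.

Lemma interval_sup_ge x y : bl_le 0 y -> bl_le y x -> w y <= interval_sup x.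
Proof.
move=> y0 yx; apply: ub_le_sup; last by exists y.
by exists (`|w| * `|x|) => r; exact: order_interval_image_le.
Qed.

Lemma interval_sup_le x M : bl_le 0 x ->
  (forall y, bl_le 0 y -> bl_le y x -> w y <= M) -> interval_sup x <= M.
Proof.
move=> x0 h; apply: ge_sup; first by exists (w x), x => //; split=> //;
  exact: bl_le_refl.
by move=> _ [y [y0 yx] <-]; exact: h.
Qed.

Lemma interval_sup_ge0 x : bl_le 0 x -> 0 <= interval_sup x.
Proof.
move=> x0; rewrite -(dual0 w); apply: interval_sup_ge => //.
exact: bl_le_refl.
Qed.

Lemma interval_sup_bound x : bl_le 0 x -> interval_sup x <= `|w| * `|x|.
Proof.
move=> x0; apply: interval_sup_le => // y y0 yx.
by apply: order_interval_image_le; exists y.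
Qed.

(** The nontrivial inequality is the Riesz decomposition property: an element z
    of [0, x + y] is the sum of z /\ x, which is in [0, x], and z - z /\ x,
    which is in [0, y]. *)
Lemma interval_supD x y : bl_le 0 x -> bl_le 0 y ->
  interval_sup (x + y) = interval_sup x + interval_sup y.
Proof.
move=> x0 y0; apply/eqP; rewrite eq_le; apply/andP; split.
  apply: interval_sup_le => [|z z0 zxy]; first exact: bl_addr_ge0.
  pose a := bl_meet z x.
  have := bl_meetP z x a; rewrite bl_le_refl => /esym/andP[az ax].
  have a0 : bl_le 0 a by rewrite bl_meetP z0 x0.
  have -> : w z = w a + w (z - a) by rewrite -dualD addrC subrK.
  apply: lerD; first exact: interval_sup_ge.
  apply: interval_sup_ge; first by rewrite bl_leBr.
  have : bl_le (z - y) a.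
    rewrite bl_meetP; apply/andP; split; rewrite -bl_leBr; first by rewrite subKr.
    by rewrite opprB addrA bl_leBr.
  by rewrite -(bl_leBr (z - y)) -(bl_leBr (z - a)) !opprB !addrA (addrC a).
rewrite -lerBrDr; apply: interval_sup_le => // a a0 ax.
rewrite lerBrDr -lerBrDl; apply: interval_sup_le => // b b0 by_.
rewrite lerBrDl -dualD; apply: interval_sup_ge.
  exact: bl_addr_ge0.
rewrite -bl_leBr opprD addrACA; apply: bl_addr_ge0; by rewrite bl_leBr.
Qed.

Lemma interval_supZ a x : 0 < a -> bl_le 0 x ->
  interval_sup (a *: x) = a * interval_sup x.
Proof.
have le_ b y : 0 < b -> bl_le 0 y -> b * interval_sup y <= interval_sup (b *: y).
  move=> b0 y0; rewrite -ler_pdivlMl//; apply: interval_sup_le => // z z0 zy.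
  rewrite ler_pdivlMl// -dualZ; apply: interval_sup_ge.
    by apply: bl_scaler_ge0 => //; exact: ltW.
  by apply: bl_leZ => //; exact: ltW.
move=> a0 x0; apply/eqP; rewrite eq_le le_// andbT.
rewrite -ler_pdivrMl//; apply: le_trans (le_ _ _ _ _) _.
  by rewrite invr_gt0.
  by apply: bl_scaler_ge0 => //; exact: ltW.
by rewrite scalerA mulVf ?gt_eqF// scale1r.
Qed.

(** Every x is bl_pos x - (bl_pos x - x), a difference of positive elements, which
    fixes the linear extension of [interval_sup] from the cone. *)
Definition pos_part (x : V) : R :=
  interval_sup (bl_pos x) - interval_sup (bl_pos x - x).

(** Any decomposition of an element into positive parts gives the same value;
    linearity of the extension rests on this. *)
Lemma pos_partE a b : bl_le 0 a -> bl_le 0 b ->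
  pos_part (a - b) = interval_sup a - interval_sup b.
Proof.
move=> a0 b0; rewrite /pos_part; set p := bl_pos _.
have p0 : bl_le 0 p by exact: bl_pos_ge0.
have q0 : bl_le 0 (p - (a - b)) by exact: bl_neg_ge0.
have := interval_supD a0 q0; have := interval_supD p0 b0.
have -> : a + (p - (a - b)) = p + b by rewrite opprB addrCA subrKC.
lra.
Qed.

Lemma pos_part_cone x : bl_le 0 x -> pos_part x = interval_sup x.
Proof.
move=> x0; have := interval_supD x0 (bl_le_refl 0).
rewrite addr0 => h; rewrite -[in LHS](subr0 x).
rewrite (pos_partE x0 (bl_le_refl 0)); lra.
Qed.

Lemma pos_part_linear a x y :
  pos_part (a *: x + y) = a * pos_part x + pos_part y.
Proof.
have extD s t : pos_part (s + t) = pos_part s + pos_part t.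
  have -> : s + t = (bl_pos s + bl_pos t) - ((bl_pos s - s) + (bl_pos t - t)).
    by rewrite opprD !opprB addrACA !subrKC.
  rewrite (pos_partE (bl_addr_ge0 (bl_pos_ge0 s) (bl_pos_ge0 t))
    (bl_addr_ge0 (bl_neg_ge0 s) (bl_neg_ge0 t))).
  rewrite (interval_supD (bl_pos_ge0 s) (bl_pos_ge0 t)).
  rewrite (interval_supD (bl_neg_ge0 s) (bl_neg_ge0 t)) /pos_part; lra.
have extN z : pos_part (- z) = - pos_part z.
  have -> : - z = (bl_pos z - z) - bl_pos z by rewrite addrAC subrr add0r.
  rewrite pos_partE ?bl_pos_ge0 ?bl_neg_ge0// /pos_part; lra.
have extZ b r : 0 < b -> pos_part (b *: r) = b * pos_part r.
  move=> b0; have -> : b *: r = b *: bl_pos r - b *: (bl_pos r - r).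
    by rewrite -scalerBr subKr.
  have b0' := ltW b0.
  rewrite pos_partE ?bl_scaler_ge0 ?bl_pos_ge0 ?bl_neg_ge0//.
  by rewrite !interval_supZ ?bl_pos_ge0 ?bl_neg_ge0// /pos_part mulrBr.
rewrite extD; congr (_ + _).
have [a0|a0|->] := ltgtP a 0.
- by rewrite -{1}[a]opprK scaleNr extN extZ ?oppr_gt0// mulNr opprK.
- exact: extZ.
- rewrite scale0r mul0r -[0 in LHS](subrr 0).
  by rewrite (pos_partE (bl_le_refl 0) (bl_le_refl 0)) subrr.
Qed.

(** The factor 3 is crude, but only the existence of a bound matters: it comes
    from |bl_pos x| <= |x| and |bl_pos x - x| <= 2 |x|. *)
Lemma dual_majorant : exists p : dual V,
  [/\ dual_le 0 p, dual_le w p & `|p| <= 3 * `|w|].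
Proof.
have bnd x : `|pos_part x| <= 3 * `|w| * `|x|.
  rewrite (le_trans (ler_normB _ _))// !ger0_norm; last 2 first.
    exact/interval_sup_ge0/bl_neg_ge0.
    exact/interval_sup_ge0/bl_pos_ge0.
  rewrite (le_trans (lerD (interval_sup_bound (bl_pos_ge0 x))
     (interval_sup_bound (bl_neg_ge0 x))))//.
  rewrite -mulrDr (mulrC 3) -mulrA ler_wpM2l//.
  have := bl_norm_pos x; have := bl_norm_neg x; lra.
have [p pE] := dual_of_bounded_linear pos_part_linear bnd.
exists p; split=> [x x0|x x0|].
- by rewrite pE pos_part_cone//; exact: interval_sup_ge0.
- rewrite pE pos_part_cone//; apply: interval_sup_ge => //; exact: bl_le_refl.
- apply: dual_norm_le => [x|]; first by rewrite pE.
  by rewrite mulr_ge0.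
Qed.

End dual_majorant.

(** * Convergence *)

Lemma weakstar_cvgP {R : realType} {U : normedModType R} (x : nat -> dual U)
    (l : dual U) :
  (x : nat -> weakstar U) @ \oo --> (l : weakstar U) <->
  forall z, (x n z : R) @[n --> \oo] --> (l z : R).
Proof.
pose e (g : dual U) := (g : U -> R) : prod_topology (fun _ : U => R).
have ce : continuous (e : weakstar U -> _) by exact: initial_continuous.
split=> [xl z|xl].
  have h : (fun n => e (x n)) @ \oo --> e l.
    by apply: (cvg_comp (x : nat -> weakstar U) e xl); exact: ce.
  exact: (cvg_comp _ _ h (@proj_continuous _ (fun=> R) z (e l))).
have el : (fun n => e (x n)) @ \oo --> e l.
  apply/cvg_sup => z; apply/cvg_image.
    by rewrite eqEsubset; split => // r _; exists (fun=> r).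
  move=> B /(xl z) zB; exists ((fun g : U -> R => g z) @^-1` B) => //.
  rewrite image_preimage// eqEsubset; split => // r _; by exists (fun=> r).
move=> B /= [_ [[B' oO <-] Ol OB]].
have : nbhs (e l) B' by exact: open_nbhs_nbhs.
move=> /el eB; rewrite nbhs_filterE.
exact: (@filterS _ (x @ \oo) _ (e @^-1` B') B OB eB).
Qed.

(** A weakly-* convergent sequence is pointwise bounded, hence norm bounded by
    the Banach-Steinhaus theorem, as the predual is complete. *)
Lemma weakstar_cvg_bounded {R : realType} {U : completeNormedModType R}
    (x : nat -> dual U) (l : dual U) :
  (x : nat -> weakstar U) @ \oo --> (l : weakstar U) ->
  exists2 M, 0 <= M & forall n, `|x n| <= M.
Proof.
move=> /weakstar_cvgP xl.
pose F : set (U -> R^o) := range (fun n => dual_val (x n)).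
have Fb g : F g -> bounded_fun_norm g /\ linear g.
  move=> [n _ <-]; split; last exact: dual_linear.
  move=> r; exists (`|x n| * r) => z zr.
  by rewrite (le_trans (dual_ler _ _))// ler_wpM2l.
have Fp : pointwise_bounded F.
  move=> z; have /cvg_seq_bounded/pinfty_ex_gt0[M M0 xM] := cvgP _ (xl z).
  by exists M => _ [n _ <-]; exact: xM.
have [M FM] := Banach_Steinhauss Fb Fp 1.
exists (Num.max M 0); first by rewrite le_max lexx orbT.
move=> n; apply: opnorm_le => z z1; rewrite le_max.
by rewrite (FM (dual_val (x n)))//; exists n.
Qed.

Lemma lower_semicontinuous_lim_le {R : realType} {T : topologicalType}
    (F : T -> \bar R) (x : nat -> T) (l : T) (r : nat -> R) (r0 : R) :
  lower_semicontinuous F -> x @ \oo --> l -> r @ \oo --> r0 ->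
  (forall n, F (x n) <= (r n)%:E)%E -> (F l <= r0%:E)%E.
Proof.
move=> lscF xl rr0 Fr; apply/lee_addgt0Pr => e e0.
rewrite leNgt; apply/negP => /lscF[N Nl NF].
have nN : \forall n \near \oo, N (x n) by exact: xl Nl.
have nr : \forall n \near \oo, r n < r0 + e.
  by apply: (cvgr_lt r0) rr0 _ _; rewrite ltrDl.
have [n [/NF Fn rn]] := filter_ex (filterI nN nr).
by have := lt_le_trans Fn (Fr n); rewrite lte_fin ltNge ltW.
Qed.

Lemma increasing_seq_cvg_infty (phi : nat -> nat) :
  increasing_seq phi -> phi @ \oo --> \oo.
Proof.
move=> iphi; have ge n : (n <= phi n)%N.
  elim: n => // n IHn; apply: (leq_ltn_trans IHn).
  by have /increasing_seqP := iphi; exact.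
move=> B [N _ NB]; exists N => // n /= Nn; apply: NB => /=.
exact: leq_trans (ge n).
Qed.

(** Otherwise some neighbourhood of [l] is missed infinitely often, and the
    subsequence of the missing terms has no further subsequence tending to [l]. *)
Lemma subseq_cvg_to_set1 {T : topologicalType} (x : nat -> T) (l : T) :
  subseq_cvg_to x [set l] -> x @ \oo --> l.
Proof.
move=> xl N Nl; rewrite nbhs_filterE; apply: contrapT => xN.
have ex m : exists n, (m < n)%N /\ ~ N (x n).
  apply: contrapT => h; apply: xN; exists m.+1 => // n /= mn.
  by apply: contrapT => xn; apply: h; exists n.
have [g gP] := choice ex.
pose phi n := iter n.+1 g 0%N.
have iphi : increasing_seq phi.
  by apply/increasing_seqP => n; exact: (gP (phi n)).1.
have [psi ipsi [_ -> cv]] := xl phi iphi.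
have nN : \forall n \near \oo, N (x (phi (psi n))) by exact: cv N Nl.
have [n Nn] := filter_ex nN.
by have [_ /(_ Nn)] := gP (iter (psi n) g 0%N).
Qed.

(** * Convergence of the regularised solutions *)

(** For a positive functional x, positivity of A - Al and Au - A gives
    0 <= A x - Al x <= (Au - Al) x, so A x - Al x is controlled by the norm of
    Au - Al.  A general w is the difference of its majorant p and p - w, both
    positive, of norms at most 3 |w| and 4 |w|; adding the slack
    0 <= y - Al w <= (Au - Al) w of feasibility gives the factor 8 on the
    positive cone.  The factor 24 is 8 * (1 + 2), from splitting an arbitrary z
    into bl_pos z and bl_pos z - z. *)
Lemma feasible_near {R : realType} {U V : banachLatticeType R}
    (A Al Au : {linear dual U -> dual V}) (w : dual U) (y : dual V) :
  continuous Al -> continuous Au -> op_le Al A -> op_le A Au ->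
  feasible Al Au w y ->
  `|y - A w| <= 24 * opnorm (Au \- Al) * `|w|.
Proof.
move=> cAl cAu lA Au_ [ly yu].
set D := opnorm _.
have cD : continuous (Au \- Al).
  by move=> x; apply: continuousB; [exact: cAu|exact: cAl].
have lD : linear (Au \- Al) by exact: linearP.
have D0 : 0 <= D by exact: opnorm_ge0.
have Db x z : bl_le 0 z -> Au x z - Al x z <= D * `|x| * `|z|.
  move=> z0; rewrite -[leLHS]/((Au \- Al) x z) (le_trans (ler_norm _))//.
  by rewrite (le_trans (dual_ler _ _))// ler_wpM2r//; exact: opnorm_ler.
have pos x z : bl_le 0 z -> dual_le 0 x ->
    0 <= A x z - Al x z <= D * `|x| * `|z|.
  move=> z0 x0; rewrite subr_ge0 lA//= (le_trans _ (Db _ _ z0))// lerD2r.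
  exact: Au_.
have [p [p0 wp pn]] := dual_majorant w.
have q0 : dual_le 0 (p - w) by move=> z z0; rewrite subr_ge0; exact: wp.
have qn : `|p - w| <= 4 * `|w|.
  by rewrite (le_trans (ler_normB _ _))//; lra.
have sub (P : {linear dual U -> dual V}) z : P (p - w) z = P p z - P w z.
  by rewrite linearB.
have Ew z : bl_le 0 z -> `|y z - A w z| <= 8 * D * `|w| * `|z|.
  move=> z0; have /andP[a1 a2] := pos _ _ z0 p0.
  have /andP[b1 b2] := pos _ _ z0 q0.
  have c1 := ly _ z0; have c2 := yu _ z0; have c3 := Db w _ z0.
  rewrite !sub in b1 b2.
  have Dz : 0 <= D * `|z| by rewrite mulr_ge0.
  have pn' : D * `|p| * `|z| <= 3 * (D * `|w| * `|z|).
    by move: (ler_wpM2l Dz pn); lra.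
  have qn' : D * `|p - w| * `|z| <= 4 * (D * `|w| * `|z|).
    by move: (ler_wpM2l Dz qn); lra.
  rewrite ler_norml; apply/andP; split; lra.
apply: dual_norm_le => [z|]; last by rewrite !mulr_ge0.
have E s t : (y - A w) (s - t) = (y s - A w s) - (y t - A w t).
  have dB (g : dual V) : g (s - t) = g s - g t.
    by rewrite dualD -scaleN1r dualZ mulN1r.
  change (y (s - t) - A w (s - t) = (y s - A w s) - (y t - A w t)).
  rewrite !dB; lra.
rewrite -{1}(subKr (bl_pos z) z) E (le_trans (ler_normB _ _))//.
rewrite (le_trans (lerD (Ew _ (bl_pos_ge0 z)) (Ew _ (bl_neg_ge0 z))))//.
have Dw : 0 <= 8 * D * `|w| by rewrite !mulr_ge0.
have := ler_wpM2l Dw (bl_norm_pos z); have := ler_wpM2l Dw (bl_norm_neg z).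
lra.
Qed.

(** The distance from y_n to A w_n is of order eta_n by [feasible_near], the
    w_n being bounded, so y_n inherits the weak-* limit of A w_n. *)
Lemma feasible_weakstar_cvg {R : realType} {U V : banachLatticeType R}
    (A : {linear dual U -> dual V}) (Al Au : nat -> {linear dual U -> dual V})
    (eta : nat -> R) (w : nat -> dual U) (y : nat -> dual V) (l : dual U) :
  (forall n, continuous (Al n)) -> (forall n, continuous (Au n)) ->
  (forall n, op_le (Al n) A) -> (forall n, op_le A (Au n)) ->
  (forall n, opnorm (Au n \- Al n) <= eta n) -> eta @ \oo --> (0 : R) ->
  weakstar_continuous A -> (forall n, feasible (Al n) (Au n) (w n) (y n)) ->
  (w : nat -> weakstar U) @ \oo --> (l : weakstar U) ->
  (y : nat -> weakstar V) @ \oo --> (A l : weakstar V).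
Proof.
move=> cAl cAu lA Au_ eta_ eta0 wA feas wl.
have [M M0 wM] := weakstar_cvg_bounded wl.
have Awl : (fun n => A (w n) : weakstar V) @ \oo --> (A l : weakstar V).
  by apply: (cvg_comp _ _ wl); exact: wA.
apply/weakstar_cvgP => z; move/weakstar_cvgP : Awl => /(_ z) Awlz.
have bound0 : 24 * eta n * M * `|z| @[n --> \oo] --> (0 : R).
  rewrite (_ : 0 = 24 * 0 * M * `|z|); last by rewrite mulr0 !mul0r.
  by apply: cvgMr_tmp; apply: cvgMr_tmp; exact: cvgMl_tmp.
have yA : (y n z - A (w n) z : R) @[n --> \oo] --> (0 : R).
  apply/norm_cvg0P; apply: (squeeze_cvgr _ (cvg_cst 0) bound0).
  apply: nearW => n; rewrite normr_ge0/=.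
  apply: (le_trans (dual_ler (y n - A (w n)) z)); rewrite ler_wpM2r//.
  apply: (le_trans
    (feasible_near (cAl n) (cAu n) (lA n) (Au_ n) (feas n))).
  apply: ler_pM => //; last by rewrite ler_wpM2l.
  rewrite mulr_ge0// opnorm_ge0//; first exact: linearP.
  by move=> x; apply: continuousB; [exact: cAu|exact: cAl].
have := cvgD yA Awlz; rewrite add0r => h.
apply: (cvg_trans _ (h _)); apply: near_eq_cvg.
by apply: nearW => n /=; rewrite subrK.
Qed.

Unset Implicit Arguments.
Set Strict Implicit.

Theorem theorem4p9 (R : realType) (U V : banachLatticeType R)
  (J : dual U -> \bar R) (H : dual V -> dual V -> \bar R)
  (A : {linear dual U -> dual V}) (Al Au : nat -> {linear dual U -> dual V})
  (fbar : dual V) (f : nat -> dual V) (delta eta : nat -> R) (tau : R)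
  (u : nat -> R -> dual U) (v : nat -> R -> dual V) (alpha : nat -> R) :
  (* exact problem *)
  continuous A -> regular_op A ->
  (exists udag : dual U,
     [/\ Jminimising J A fbar udag, dual_le 0 udag & (J udag < +oo)%E]) ->
  (* imperfect operators and data *)
  (forall n, continuous (Al n)) -> (forall n, continuous (Au n)) ->
  (forall n, op_le (Al n) A) -> (forall n, op_le A (Au n)) ->
  (forall n, opnorm (Au n \- Al n) <= eta n) -> eta @ \oo --> (0 : R) ->
  (forall n, 0 < delta n) -> (forall n, (H fbar (f n) <= (delta n)%:E)%E) ->
  delta @ \oo --> (0 : R) ->
  (* not in the source text, but the claim is false without it *)
  ((f : nat -> weakstar V) @ \oo --> (fbar : weakstar V)) ->
  1 < tau ->
  (* (i) *)
  (forall w, (0 <= J w)%E) -> proper_functional J -> convex_functional J ->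
  lower_semicontinuous (J : weakstar U -> \bar R) ->
  (forall c : R, [set w | (J w <= c%:E)%E] !=set0 ->
     seq_compact ([set w | (J w <= c%:E)%E] : set (weakstar U))) ->
  (* (ii) *)
  (forall y g, (0 <= H y g)%E) ->
  proper_functional (fun p : dual V * dual V => H p.1 p.2) ->
  (forall g, convex_functional (H^~ g)) ->
  lower_semicontinuous (fun p : weakstar V * weakstar V => H p.1 p.2) ->
  (forall y g, H y g = 0%E <-> y = g) ->
  (* (iii) *)
  weakstar_continuous A ->
  (forall n, weakstar_continuous (Al n)) ->
  (forall n, weakstar_continuous (Au n)) ->
  (* regularised solutions and discrepancy principle *)
  (forall n a, 0 < a -> solves (Al n) (Au n) H J (f n) a (u n a) (v n a)) ->
  (forall n, 0 < alpha n) ->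
  (forall n, (alpha n)%:E = ereal_sup
     [set a%:E | a in [set a : R | 0 < a /\
                         (H (v n a) (f n) <= (tau * delta n)%:E)%E]]) ->
  (forall n, H (v n (alpha n)) (f n) = (tau * delta n)%:E) ->
  let un : nat -> weakstar U := fun n => u n (alpha n) in
  (* the limit need not exist along the whole sequence when the J-minimising
     solution is not unique *)
  @subseq_cvg_to (weakstar U) un (Jminimising J A fbar) /\
  (forall uJ : dual U, Jminimising J A fbar = [set uJ] ->
     un @ \oo --> (uJ : weakstar U)).
Proof.
move=> _ _ [udag [[Audag udagmin] udag0 Judag]] cAl cAu lA Au_ eta_ eta0.
move=> delta0 Hbar delta_cvg ffbar tau1 J0 _ _ _ Jcompact H0 _ _ Hlsc HE wA _ _.
move=> sol alpha0 _ Hdisc un.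
have Jfin : J udag \is a fin_num by rewrite ge0_fin_numE.
pose c := fine (J udag).
have Jun n : (J (un n) <= c%:E)%E.
  have [_ /(_ udag fbar)] := sol n (alpha n) (alpha0 n).
  have /[swap]/[apply] : feasible (Al n) (Au n) udag fbar.
    by split; rewrite -Audag; [exact: lA|exact: Au_].
  rewrite /objective Hdisc -EFinM fineK// => le1.
  (* delta <= tau * delta, so the two data terms cancel in favour of J *)
  have le2 : (((alpha n)^-1)%:E * H fbar (f n) <=
      ((alpha n)^-1 * (tau * delta n))%:E)%E.
    apply: (@le_trans _ _ (((alpha n)^-1)%:E * (delta n)%:E)%E).
      by rewrite lee_wpmul2l// lee_fin invr_ge0 ltW.
    by rewrite -EFinM lee_fin ler_wpM2l ?invr_ge0 1?ltW// ltr_pMl.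
  by have := le_trans le1 (leeD2r (J udag) le2); rewrite leeD2lE.
have sub : @subseq_cvg_to (weakstar U) un (Jminimising J A fbar).
  move=> phi iphi.
  have [|psi ipsi [l Jl ul]] := Jcompact c _ (un \o phi) (fun n => Jun (phi n)).
    by exists udag; rewrite /= fineK.
  exists psi => //; exists l => //.
  have iphipsi : increasing_seq (phi \o psi).
    by move=> m n; rewrite /= iphi -leEnat ipsi.
  have phipsioo := increasing_seq_cvg_infty iphipsi.
  have vl : ((fun n => v (phi (psi n)) (alpha (phi (psi n)))) :
      nat -> weakstar V) @ \oo --> (A l : weakstar V).
    apply: (feasible_weakstar_cvg (fun n => cAl (phi (psi n)))
      (fun n => cAu (phi (psi n))) (fun n => lA (phi (psi n)))
      (fun n => Au_ (phi (psi n))) (fun n => eta_ (phi (psi n))) _ wA _ ul).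
      exact: cvg_comp phipsioo eta0.
    by move=> n; have [] := sol (phi (psi n)) _ (alpha0 (phi (psi n))).
  have Al_fbar : A l = fbar.
    apply/HE/eqP; rewrite eq_le H0 andbT.
    apply: (lower_semicontinuous_lim_le Hlsc
      (x := fun n => (v (phi (psi n)) (alpha (phi (psi n))) : weakstar V,
                      f (phi (psi n)) : weakstar V))
      (l := (A l : weakstar V, fbar : weakstar V))
      (r := fun n => tau * delta (phi (psi n))) (r0 := 0)).
    - have ff : ((fun n => f (phi (psi n))) : nat -> weakstar V) @ \oo -->
          (fbar : weakstar V).
        exact: cvg_comp phipsioo ffbar.
      exact: cvg_pair vl ff.
    - rewrite -(mulr0 tau); apply: cvgMl_tmp.
      exact: cvg_comp phipsioo delta_cvg.
    - by move=> n /=; rewrite Hdisc.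
  split=> // w Aw; apply: le_trans Jl _; rewrite fineK//; exact: udagmin.
split => // uJ JuJ; apply: subseq_cvg_to_set1; rewrite -JuJ; exact: sub.
Qed.
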